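(* Let $0<R_1<R_2$ and consider the metric $ds^{2}=-dt^{2}+[dr-\beta(r)\,dt]^{2}+r^{2}d\Omega^{2}$ with source components $\rho,p_r,p_\perp$ given in terms of $w(r)=r\beta(r)^2$ by $8\pi\rho=w'/r^2$, $p_r=-\rho$, $p_\perp=-w''/(16\pi r)=-\rho-\tfrac r2\rho'$. Let $\rho$ be continuous on $[R_1,R_2]$ and differentiable on $(R_1,R_2)$, and suppose that (1) $\rho(R_1)=0$; (2) $\rho(r)\ge 0$ on $[R_1,R_2]$; (3) $\rho(r_\star)>0$ for at least one $r_\star\in(R_1,R_2]$. Then the transverse null energy condition, and hence the weak energy condition, is violated at some point of $(R_1,r_\star)$: there is $c\in(R_1,r_\star)$ with $\rho(c)+p_\perp(c)<0$.
   Context: Geometric units $G=c=1$. The metric class is the unit-lapse, flat-slice radial Painlevé–Gullstrand class $ds^{2}=-dt^{2}+[dr-\beta(r)dt]^{2}+r^{2}d\Omega^{2}$. The source is $T_{\mu\nu}=G_{\mu\nu}/(8\pi)$; in the orthonormal frame of the Eulerian normal $n^\mu=(1,\beta,0,0)$ it is diagonal, with energy density $\rho$, radial pressure $p_r$, and tangential pressure $p_\perp$ (in both angular directions). With $w=r\beta^2$ these are $8\pi\rho=w'/r^2$, $p_r=-\rho$, $p_\perp=-w''/(16\pi r)=-\rho-\frac r2\rho'$. For such a source, the transverse null energy condition (NEC) is $\rho+p_\perp\ge0$. The NEC is $\rho+p_r\ge0$ and $\rho+p_\perp\ge 0$. The weak energy condition (WEC) is $\rho\ge0$ together with the NEC.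 *)

(* Defs.v *)
From HB Require Import structures.
From mathcomp Require Import all_boot all_order all_algebra.
From mathcomp Require Import all_classical all_reals all_analysis.

Set Implicit Arguments.
Unset Strict Implicit.
Unset Printing Implicit Defensive.

Import Order.TTheory GRing.Theory Num.Theory.
Import numFieldNormedType.Exports.

Local Open Scope classical_set_scope.
Local Open Scope ring_scope.

(* Derivatives are relative to the radial domain D on which the metric is
   given: two-sided (hence equal to [f^`()]) at interior points of D, one-sided
   at the end points of an interval.  This allows the metric to be merely
   continuous across the boundary of a shell. *)
Definition diff_quot (R : realType) (f : R -> R) (r s : R) : R :=
  (f s - f r) / (s - r).

Definition derivable_in (R : realType) (D : set R) (f : R -> R) (r : R) : Prop :=
  cvg (diff_quot f r s @[s --> within D r^']).

Definition derive_in (R : realType) (D : set R) (f : R -> R) (r : R) : R :=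
  lim (diff_quot f r s @[s --> within D r^']).

(* Source of ds^2 = -dt^2 + (dr - beta(r) dt)^2 + r^2 dOmega^2 with G = c = 1:
   the components of G_{mu nu} / (8 pi) in the orthonormal frame of the Eulerian
   observers n = (1, beta, 0, 0).  They depend on beta only through
   w = r beta^2, and it is w, not beta, that has to be differentiable. *)
Definition pg_w (R : realType) (beta : R -> R) (r : R) : R := r * beta r ^+ 2.

Definition energy_density (R : realType) (D : set R) (beta : R -> R) (r : R) : R :=
  derive_in D (pg_w beta) r / (8 * pi * r ^+ 2).

Definition radial_pressure (R : realType) (D : set R) (beta : R -> R) (r : R) : R :=
  - energy_density D beta r.

Definition tangential_pressure (R : realType) (D : set R) (beta : R -> R) (r : R) : R :=
  - derive_in D (derive_in D (pg_w beta)) r / (16 * pi * r).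

(* Pointwise energy conditions for a diagonal source (rho, p_r, p_perp, p_perp). *)
Definition transverse_NEC (R : realType) (rho pperp : R -> R) (r : R) : Prop :=
  0 <= rho r + pperp r.

Definition NEC (R : realType) (rho pr pperp : R -> R) (r : R) : Prop :=
  0 <= rho r + pr r /\ transverse_NEC rho pperp r.

Definition WEC (R : realType) (rho pr pperp : R -> R) (r : R) : Prop :=
  0 <= rho r /\ NEC rho pr pperp r.

(* Main.v *)
(* From 8 pi rho = w' / r^2 one gets w'' = 8 pi (2 r rho + r^2 rho') in the
   interior, so rho + p_perp = - r rho' / 2: the transverse NEC fails wherever
   rho' > 0, and the mean value theorem on [R1, rstar] supplies such a point. *)
Require Import Defs.
From HB Require Import structures.
From mathcomp Require Import all_boot all_order all_algebra.
From mathcomp Require Import all_classical all_reals all_analysis.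
From mathcomp Require Import ring.

Set Implicit Arguments.
Unset Strict Implicit.
Unset Printing Implicit Defensive.

Import Order.TTheory GRing.Theory Num.Theory.
Import numFieldNormedType.Exports.

Local Open Scope classical_set_scope.
Local Open Scope ring_scope.

(** [D] is itself a neighbourhood of [c], so intersecting with it leaves the punctured filter
    unchanged. *)
Lemma within_dnbhs_interior (T : topologicalType) (D : set T) (c : T) :
  D° c -> within D c^' = c^'.
Proof.
move=> Dc; apply/seteqP; split=> A; rewrite /dnbhs /within /= => cA.
  by apply: filterS2 Dc cA => s Ds; move=> /[swap] sc /(_ sc Ds).
by apply: filterS cA => s h sc _; exact: h.
Qed.

(** Bridge from the domain-relative derivative to the library one: the substitution [h = s - c]
    matches the two difference quotients. *)
Lemma derive_in_interior (R : realType) (D : set R) (f : R -> R) (c df : R) :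
  D° c -> is_derive c 1 f df -> derive_in D f c = df.
Proof.
move=> Dc [fc fdf]; rewrite /derive_in within_dnbhs_interior//.
apply/cvg_lim => //.
(* Injectivity of the shift keeps the limit punctured: [s != c] gives [h != 0]. *)
have shiftc : s - c @[s --> c^'] --> (0 : R)^'.
  have := @continuous_injective_withinNx R R (fun s => s - c) c.
  rewrite subrr; apply; first by apply: cvgB; [exact: cvg_id|exact: cvg_cst].
  by move=> s /eqP; rewrite subr_eq0 => /eqP.
have quot : h^-1 *: (f (h *: 1 + c) - f c) @[h --> (0 : R)^'] --> df.
  by rewrite -fdf; exact: fc.
have := cvg_comp _ _ shiftc quot; apply: cvg_trans.
apply: near_eq_cvg; near=> s.
by rewrite /= /diff_quot /GRing.scale /= mulr1 subrK mulrC.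
Unshelve. all: by end_near. Qed.

(** With [k = 8 * pi] and [f] the density, the function is w' and its derivative the w'' of the
    tangential pressure. *)
Lemma is_derive_mul_sqr (R : realType) (k : R) (f : R -> R) (c df : R) :
  is_derive c 1 f df ->
  is_derive c 1 (fun r => f r * (k * r ^+ 2)) (k * (2 * c * f c + c ^+ 2 * df)).
Proof.
move=> hf; have -> : (fun r => f r * (k * r ^+ 2)) = f * (k *: (@id R) ^+ 2).
  by apply/funext => r; rewrite /= !fctE.
apply: is_derive_eq; rewrite !fctE /GRing.scale /=; ring.
Qed.

Theorem corollary1 (R : realType) (R1 R2 : R) (hR1 : 0 < R1) (hR12 : R1 < R2)
    (beta : R -> R) :
  let D : set R := [set` `[R1, R2]] in
  let rho := energy_density D beta in
  let pr := radial_pressure D beta in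
  let pperp := tangential_pressure D beta in
  (forall r : R, D r -> derivable_in D (pg_w beta) r) ->
  {within D, continuous rho} ->
  (forall r : R, R1 < r < R2 -> derivable rho r 1) ->
  rho R1 = 0 ->
  (forall r : R, R1 <= r <= R2 -> 0 <= rho r) ->
  forall rstar : R, R1 < rstar <= R2 -> 0 < rho rstar ->
  exists c : R,
    [/\ R1 < c < rstar,
        rho c + pperp c < 0,
        ~ transverse_NEC rho pperp c
      & ~ WEC rho pr pperp c].
Proof.
move=> D rho pr pperp _ rho_cont rho_drv rho1 _ rstar /andP[r1s rs2] rhos.
have drv r : r \in `]R1, rstar[ -> is_derive r 1 rho ('D_1 rho r).
  rewrite in_itv /= => /andP[h1 h2]; apply/derivableP.
  by apply: rho_drv; rewrite h1 (lt_le_trans h2).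
have cont : {within `[R1, rstar], continuous rho}.
  by apply: continuous_subspaceW rho_cont; apply: subset_itvl; rewrite bnd_simp.
have [c cI] := MVT r1s drv cont.
rewrite rho1 subr0 => rhoE.
have d_gt0 : 0 < 'D_1 rho c.
  by rewrite -(pmulr_lgt0 _ (_ : 0 < rstar - R1)) ?subr_gt0// -rhoE.
have := drv c cI; move: cI; rewrite in_itv /= => /andP[c1 cs] dc.
have c_gt0 : 0 < c by exact: lt_trans c1.
have pi0 := pi_gt0 R.
(* The definition of the density solved for w'. At [r = 0] the quotient is 0 by convention and does
   not determine w'. *)
have wE r : r != 0 -> derive_in D (pg_w beta) r = rho r * (8 * pi * r ^+ 2).
  by move=> r0; rewrite /rho /energy_density divfK// !mulf_neq0// gt_eqF.
have w2 : derive_in D (derive_in D (pg_w beta)) c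
    = 8 * pi * (2 * c * rho c + c ^+ 2 * 'D_1 rho c).
  apply: derive_in_interior.
    (* Since [c < rstar], the point [c] is interior to [D] even when [rstar = R2]. *)
    by rewrite interior_itv_bnd; rewrite /= in_itv/= c1 (lt_le_trans cs).
  (* Agreement of w' with the product near [c > 0], away from the origin, is enough; w'' thus comes
     from the differentiability of [rho]. *)
  apply: near_eq_is_derive (is_derive_mul_sqr (8 * pi) dc).
  near=> r; rewrite wE //; near: r.
  by apply: open_nbhs_nbhs; split; [exact: open_neq|rewrite /= gt_eqF].
have neg : rho c + pperp c < 0.
  have -> : rho c + pperp c = - (c / 2 * 'D_1 rho c).
    rewrite /pperp /tangential_pressure w2.
    (* [field] would unfold [pi] *)
    move: (rho c) ('D_1 rho c) (pi : R) pi0 => x y p p_gt0.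
    by field; rewrite !gt_eqF.
  by rewrite oppr_lt0 mulr_gt0 ?divr_gt0.
have nT : ~ transverse_NEC rho pperp c by rewrite /transverse_NEC leNgt neg.
by exists c; split=> //; [rewrite c1 | case=> _ []].
Unshelve. all: by end_near.
Qed.
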